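(* Let $r\geq5$ be odd, and let $u\in W(D_r)$ be rational with $u\neq w_0$. Then there is a simple root $\alpha_a$ ($1\leq a\leq r$) such that $u^{-1}(\alpha_a)>0$ and $u(\alpha_a)<0$, the element $s_au$ is rational, and $\ell(s_au)=\ell(u)+1$.
   Context: Let $e_1,\ldots,e_r$ be the standard orthonormal basis of $\mathbb R^r$. $W(D_r)$ is the group of linear maps $u$ with $u(e_j)=\varepsilon_j e_{\pi(j)}$, $\pi\in S_r$, $\varepsilon_j\in\{\pm1\}$, with an even number of negative signs. Positive roots: $\Pi_+=\{e_i-e_j,\ e_i+e_j:1\leq i<j\leq r\}$; for a root $\beta$, $\beta>0$ means $\beta\in\Pi_+$ and $\beta<0$ means $\beta\in-\Pi_+$. Simple roots: $\alpha_i=e_i-e_{i+1}$ ($1\leq i\leq r-1$), $\alpha_r=e_{r-1}+e_r$; $s_a$ is the reflection in $\alpha_a$, and $\ell$ is the Coxeter length with respect to $s_1,\ldots,s_r$. The longest element $w_0$ is given by $w_0(e_i)=-e_i$ ($1\leq i\leq r-1$), $w_0(e_r)=e_r$. Root order: $\rho\leq\eta$ iff $\eta-\rho\in\sum_{a=1}^r\mathbb Z_{\geq0}\alpha_a$. For $S\subseteq\Pi_+$ let $\operatorname{Adj}(S)=\{\gamma\in\Pi_+:\gamma\leq\beta\text{ for some }\beta\in S\}$. For $u\in W(D_r)$ let $\nu_0(u)=u(\Pi_+)\cap\Pi_+$ and $\nu_k(u)=u(\operatorname{Adj}(\nu_{k-1}(u)))\cap\Pi_+$ for $k\geq1$. The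 element $u$ is rational if $\nu_k(u)=\varnothing$ for all sufficiently large $k$. *)

(* Defs.v *)
From mathcomp Require Import all_boot all_order all_algebra all_fingroup.
From mathcomp Require Import boolp classical_sets reals.

Set Implicit Arguments.
Unset Strict Implicit.
Unset Printing Implicit Defensive.

Import Order.TTheory GRing.Theory Num.Theory.

Local Open Scope classical_set_scope.
Local Open Scope ring_scope.

(* Linear endomorphisms of R^r are r x r matrices acting on column vectors.   *)
(* Indices run from 0 to r - 1, so [basis_vec R r i] is e_{i+1}; it is indexed *)
(* by nat to avoid ordinal casts, and vanishes for i >= r.                     *)
Definition basis_vec (R : realType) (r : nat) (i : nat) : 'cV[R]_r :=
  \col_(j < r) (nat_of_ord j == i)%:R.

Definition in_WD (R : realType) (r : nat) (u : 'M[R]_r) : Prop :=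
  exists (p : 'S_r) (neg : 'I_r -> bool),
    ~~ odd #|[set j : 'I_r | neg j]%SET| /\
    forall j : 'I_r,
      u *m basis_vec R r j = (-1) ^+ neg j *: basis_vec R r (p j).

Definition pos_roots (R : realType) (r : nat) : set 'cV[R]_r :=
  [set v | exists i j : 'I_r, (i < j)%N /\
     (v = basis_vec R r i - basis_vec R r j \/
      v = basis_vec R r i + basis_vec R r j)].
Arguments pos_roots : clear implicits.

Definition root_pos (R : realType) (r : nat) (b : 'cV[R]_r) : Prop :=
  pos_roots R r b.

Definition root_neg (R : realType) (r : nat) (b : 'cV[R]_r) : Prop :=
  pos_roots R r (- b).

Definition simple_root (R : realType) (r : nat) (a : 'I_r) : 'cV[R]_r :=
  if (a.+1 < r)%N then basis_vec R r a - basis_vec R r a.+1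
  else basis_vec R r r.-2 + basis_vec R r r.-1.

Definition dotv (R : realType) (r : nat) (v w : 'cV[R]_r) : R :=
  \sum_(i < r) v i 0 * w i 0.

(* Matrix of the orthogonal reflection v |-> v - 2 (v, b) / (b, b) b. *)
Definition reflection_mx (R : realType) (r : nat) (b : 'cV[R]_r) : 'M[R]_r :=
  1%:M - (2 / dotv b b) *: (b *m b^T).

Definition simple_refl (R : realType) (r : nat) (a : 'I_r) : 'M[R]_r :=
  reflection_mx (simple_root R a).

Definition word_mx (R : realType) (r : nat) (w : seq 'I_r) : 'M[R]_r :=
  foldr (fun a m => simple_refl R a *m m) 1%:M w.

Definition has_word (R : realType) (r : nat) (u : 'M[R]_r) (n : nat) : bool :=
  [exists w : n.-tuple 'I_r, u == word_mx R w].

(* The value 0 in the second branch is a junk value: it is only taken by      *)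
(* matrices outside the group generated by the simple reflections.            *)
Definition coxeter_length (R : realType) (r : nat) (u : 'M[R]_r) : nat :=
  if pselect (exists n, has_word u n) is left h then ex_minn h else 0%N.

Definition longest_elt (R : realType) (r : nat) : 'M[R]_r :=
  diag_mx (\row_(i < r) (if (i.+1 < r)%N then -1 else 1)).

Definition root_le (R : realType) (r : nat) (rho eta : 'cV[R]_r) : Prop :=
  exists c : 'I_r -> nat, eta - rho = \sum_(a < r) simple_root R a *+ c a.

Definition Adj (R : realType) (r : nat) (S : set 'cV[R]_r) : set 'cV[R]_r :=
  [set g | pos_roots R r g /\ exists2 b, S b & root_le g b].

Fixpoint nu (R : realType) (r : nat) (u : 'M[R]_r) (k : nat) : set 'cV[R]_r :=
  if k is k'.+1 then (mulmx u @` Adj (nu u k')) `&` pos_roots R r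
  else (mulmx u @` pos_roots R r) `&` pos_roots R r.

Definition rational_elt (R : realType) (r : nat) (u : 'M[R]_r) : Prop :=
  exists K : nat, forall k : nat, (K <= k)%N -> nu u k = set0.

(* Main.v *)
Require Import Defs.
From mathcomp Require Import all_boot all_order all_algebra all_fingroup.
From mathcomp Require Import boolp classical_sets reals.
From mathcomp Require Import zify ring lra.

Set Implicit Arguments.
Unset Strict Implicit.
Unset Printing Implicit Defensive.

Import Order.TTheory GRing.Theory Num.Theory.

Local Open Scope ring_scope.

(** The rational elements can be listed explicitly, and the list makes the
    required simple root visible.  Indices run from 0 to L = r - 1, and f is the
    orthonormal basis with f_k = e_k for k < L and f_L = e_L or f_L = - e_L; the
    choice of sign is the diagram automorphism of D_r, which preserves the set
    of positive roots and the root order.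

    Classification ([rational_opposite_rise]).  For r odd, u is rational only if
    for one of the two choices of f there is a permutation p with
    u f_k = - f_(p k) and k <= p k for k < L, and u f_L = f_(p L).  Every
    exclusion uses the same obstruction ([trap_not_rational]): a nonempty set T
    of positive roots, mapped by u to positive roots, in which each v satisfies
    v <= u w for some w in T, is carried into every nu_k.  One root v with
    v <= u v is enough except in one case, where T has two elements.  Testing
    e_j - e_k and e_j + e_k as v, with pigeonhole arguments on intervals, shows
    that u has at most one positive sign, at L or at the index sent to L; since
    the number of negative signs is even and r is odd, there is one.  The
    remaining tests forbid i < j < L with p j <= i and j <= p i, which forces
    k <= p k.

    Converse ([opposite_rise_rational]).  A permutation with k <= p k for all
    k < L has at most one nontrivial cycle, i_1 < i_2 < ... < L.  If v and u v
    are both positive then u v has coordinate sum 0 in the basis f; hence a root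
    v <= u v' of this kind is some f_i - f_j with i < j = p j < p i.  Two such
    roots in succession would need a moved index strictly between i and p i, so
    nu_2 is empty.

    Choice of the simple root ([opposite_rise_step]).  As u is not w_0, the
    index i = p L is less than L.  With y = p i and x = y - 1 take the simple
    root f_x - f_y: either x = i or x is fixed by p, so both sign conditions can be
    read off, and left multiplication by the reflection exchanges the values x
    and y of p, which preserves the shape of the classification.

    Length ([coxeter_length_simple_refl]).  The Coxeter length is the number of
    positive roots v with u^-1 v negative, and a simple reflection permutes the
    positive roots other than its own. *)

(** * Permutations of an interval *)

Section PermCombinatorics.
Variable n : nat.
Implicit Types (p : 'S_n.+1) (i j k x : 'I_n.+1).

Lemma neq_ord_max k : (k != ord_max) = (k < n)%N.
Proof. by rewrite ltn_neqAle -ltnS ltn_ord andbT. Qed.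

Lemma perm_card_le p (A B : {set 'I_n.+1}) :
  (forall i, i \in A -> p i \in B) -> (#|A| <= #|B|)%N.
Proof.
move=> pAB; rewrite -(card_imset (mem A) (@perm_inj _ p)).
by apply/subset_leq_card/fintype.subsetP => _ /imsetP[i iA ->]; exact: pAB.
Qed.

Lemma perm_no_miss p (A : {set 'I_n.+1}) x :
  x \in A -> (forall i, i \in A -> p i \in A /\ p i != x) -> False.
Proof.
move=> xA pA.
have /perm_card_le : forall i, i \in A -> p i \in A :\ x.
  by move=> i /pA[piA pix]; rewrite in_setD1 pix.
by rewrite [leqLHS](cardsD1 x) xA ltnn.
Qed.

Lemma perm_ge_id p : (forall k, (k <= p k)%N) -> p = 1%g.
Proof.
move=> le_p; apply/permP => k; rewrite perm1; apply/val_inj/esym/eqP.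
have [_] := leqif_sum (fun i (_ : true) => leqif_eq (le_p i)).
by rewrite (reindex_inj (@perm_inj _ p)) eqxx => /esym/forallP/(_ k).
Qed.

Lemma perm_increasing_id p :
  (forall i j, (i < j)%N -> (p i < p j)%N) -> p = 1%g.
Proof.
move=> pincr; apply: perm_ge_id; case=> d; elim: d => // d IHd ltd.
exact: leq_ltn_trans (IHd (ltnW ltd)) (pincr (Ordinal (ltnW ltd)) (Ordinal ltd) _).
Qed.

(** A permutation lowering no index but the last has at most one nontrivial
    cycle, which climbs to the last index and drops back once, so nothing moves strictly between an index
    and its image.  If x moved, then i and the indices of [x, max) would all be
    sent into (x, max], which is one place too small. *)
Lemma perm_rise_gap p i x :
  (forall k, k != ord_max -> (k <= p k)%N) -> i != ord_max ->
  (i < x)%N -> (x < p i)%N -> p x = x.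
Proof.
move=> le_p iL ix xpi; apply/val_inj/eqP; case: eqP => // /eqP px.
have xL : x != ord_max by rewrite neq_ord_max (leq_trans xpi) // -ltnS.
have ltpx : (x < p x)%N by rewrite ltn_neqAle eq_sym px le_p.
pose U := [set k : 'I_n.+1 | (x <= k)%N].
have : (#|i |: (U :\ ord_max)| <= #|U :\ x|)%N.
  apply: (@perm_card_le p) => k; rewrite !inE -!val_eqE /=.
  case/orP => [/eqP/val_inj->|/andP[kL]]; first by rewrite gtn_eqF // ltnW.
  rewrite leq_eqVlt => /orP[/eqP/val_inj<-|xk]; first by rewrite gtn_eqF // ltnW.
  have := leq_trans xk (le_p k kL) => xpk.
  by rewrite gtn_eqF // ltnW.
rewrite cardsU1 !inE (leqNgt x i) ix andbF /=.
have := cardsD1 ord_max U; have := cardsD1 x U; rewrite !inE leqnn -ltnS ltn_ord /=.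
lia.
Qed.

(** Among the indices below the maximum that go down, take the j with the lowest
    image.  Every index of [p j, j] stays below j because crossings are
    excluded, and stays above p j by the choice of j: a pigeonhole
    contradiction. *)
Lemma perm_no_cross_rise p :
  (forall i j, (i < j)%N -> j != ord_max -> (p j <= i)%N -> (p i < j)%N) ->
  forall k, k != ord_max -> (k <= p k)%N.
Proof.
move=> ncross k0 k0L; rewrite leqNgt; apply/negP => pk0.
pose P := fun k => (k != ord_max) && (p k < k)%N.
have Pk0 : P k0 by rewrite /P k0L.
case: (arg_minnP (fun k => nat_of_ord (p k)) Pk0) => j /andP[jL pj] minj.
apply: (@perm_no_miss p [set i : 'I_n.+1 | p j <= i <= j]%N j).
  by rewrite inE leqnn ltnW.
move=> i; rewrite !inE => /andP[pji ij].
have pij : (p i < j)%N.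
  by move: ij; rewrite leq_eqVlt => /orP[/eqP/val_inj->//|ij]; exact: ncross.
have iL : i != ord_max by rewrite neq_ord_max (leq_ltn_trans ij) -?neq_ord_max.
rewrite (ltnW pij) andbT -val_eqE /= ltn_eqF //; split=> //.
rewrite leqNgt; apply/negP => pipj.
have /minj : P i by rewrite /P iL (leq_trans pipj).
by rewrite leqNgt pipj.
Qed.

End PermCombinatorics.

(** * Roots in the twisted basis *)

Section TwistedBasis.
Variables (R : realType) (n : nat).
Notation I := 'I_n.+2.
Notation V := 'cV[R]_n.+2.
Implicit Types (b s t : bool) (i j k x y m a : I) (v w : V).

(** The basis f described above, with [b] the choice of sign on the last
    vector.  The entries are given directly, so that scaling lemmas do not match
    inside the definition. *)
Definition tbasis b k : V :=
  \col_i ((-1) ^+ (b && (k == ord_max)) * (i == k)%:R).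

Lemma tbasis_basis b k :
  tbasis b k = (-1) ^+ (b && (k == ord_max)) *: basis_vec R n.+2 k.
Proof. by apply/matrixP => i j; rewrite !mxE val_eqE. Qed.

Definition ord_penult : I := inord n.

Lemma val_penult : ord_penult = n :> nat.
Proof. by rewrite inordK. Qed.

Lemma basis_tbasis b k :
  basis_vec R n.+2 k = (-1) ^+ (b && (k == ord_max)) *: tbasis b k.
Proof. by rewrite tbasis_basis scalerA -signr_addb addbb scale1r. Qed.

Lemma le_ord_max k : (k <= @ord_max n.+1)%N.
Proof. by rewrite -ltnS. Qed.

Lemma tbasis_false k : tbasis false k = basis_vec R n.+2 k.
Proof. by rewrite tbasis_basis scale1r. Qed.

Lemma tbasis_neq_max b k : k != ord_max -> tbasis b k = basis_vec R n.+2 k.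
Proof. by move/negbTE=> kL; rewrite tbasis_basis kL andbF scale1r. Qed.

Lemma tbasisE b k i :
  tbasis b k i 0 = (-1) ^+ (b && (k == ord_max)) * (i == k)%:R.
Proof. by rewrite mxE. Qed.

Lemma tbasis_sign b c k :
  tbasis b k = (-1) ^+ ((b (+) c) && (k == ord_max)) *: tbasis c k.
Proof. by rewrite !tbasis_basis scalerA -signr_addb -andb_addl -addbA addbb addbF. Qed.

Lemma basis_vec_delta k : basis_vec R n.+2 k = delta_mx k 0.
Proof. by apply/matrixP => i j; rewrite !mxE ord1 eqxx andbT val_eqE. Qed.

Lemma mulmx_tbasis_ext b d (A B : 'M[R]_(d, n.+2)) :
  (forall k, A *m tbasis b k = B *m tbasis b k) -> A = B.
Proof.
move=> eqAB; have {}eqAB k : A *m (delta_mx k 0 : V) = B *m (delta_mx k 0 : V).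
  by rewrite -basis_vec_delta (basis_tbasis b) -!scalemxAr eqAB.
apply/matrixP => i k; have := eqAB k.
by rewrite -!colE => /matrixP/(_ i 0); rewrite !mxE.
Qed.

(** The description of the positive roots is insensitive to the sign of f_L. *)
Lemma pos_rootsP b v :
  pos_roots R n.+2 v <->
  exists i j s, (i < j)%N /\ v = tbasis b i + (-1) ^+ s *: tbasis b j.
Proof.
split=> [[i [j [ij vE]]]|[i [j [s [ij ->]]]]].
  have iL : i != ord_max by rewrite neq_ord_max (leq_trans ij) // -ltnS.
  have {vE}[s ->] : exists s,
      v = basis_vec R n.+2 i + (-1) ^+ s *: basis_vec R n.+2 j.
    by case: vE => ->; [exists true|exists false]; rewrite ?scale1r ?scaleN1r.
  exists i, j, (s (+) (b && (j == ord_max))); split=> //.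
  by rewrite (basis_tbasis b j) (tbasis_neq_max b iL) scalerA signr_addb.
have iL : i != ord_max by rewrite neq_ord_max (leq_trans ij) // -ltnS.
exists i, j; split=> //; rewrite (tbasis_neq_max b iL) tbasis_basis scalerA -signr_addb.
by case: (_ (+) _); [left|right]; rewrite ?scale1r ?scaleN1r.
Qed.

Lemma pos_root_tbasis b i j s :
  (i < j)%N -> pos_roots R n.+2 (tbasis b i + (-1) ^+ s *: tbasis b j).
Proof. by move=> ij; apply/(pos_rootsP b); exists i, j, s. Qed.

Lemma pos_root_sub b i j : (i < j)%N -> pos_roots R n.+2 (tbasis b i - tbasis b j).
Proof. by move=> ij; rewrite -scaleN1r; exact: (@pos_root_tbasis b i j true). Qed.

Lemma pos_root_add b i j : i != j -> pos_roots R n.+2 (tbasis b i + tbasis b j).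
Proof.
by rewrite -val_eqE neq_ltn => /orP[]ij; last rewrite addrC;
  rewrite -[X in _ + X]scale1r; exact: (@pos_root_tbasis b _ _ false).
Qed.

(** Both simple roots at the fork of the Dynkin diagram are covered by
    differences of consecutive basis vectors once the sign of the last one may be chosen, so
    every simple reflection exchanges two consecutive basis vectors. *)
Lemma simple_root_tbasis a :
  exists b x y, y = x.+1 :> nat /\ simple_root R a = tbasis b x - tbasis b y.
Proof.
rewrite /simple_root; case: ltnP => [lta|gea].
  by exists false, a, (Ordinal lta); rewrite !tbasis_false.
exists true, ord_penult, ord_max; rewrite val_penult; split=> //=.
rewrite tbasis_neq_max ?neq_ord_max ?val_penult //.
by rewrite tbasis_basis eqxx /= scaleN1r opprK.
Qed.

Lemma tbasis_simple_sub b x y :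
  y = x.+1 :> nat -> exists a, simple_root R a = tbasis b x - tbasis b y.
Proof.
move=> yx; have xL : x != ord_max by rewrite neq_ord_max -ltnS -yx.
rewrite (tbasis_neq_max _ xL); have [yL|yL] := eqVneq y ord_max; last first.
  by exists x; rewrite /simple_root -yx ltn_ord tbasis_neq_max.
have xn : x = n :> nat by move: yx; rewrite yL => -[].
rewrite yL tbasis_basis eqxx andbT.
case: b; [exists ord_max|exists x]; rewrite /simple_root /=.
  by rewrite ltnn scaleN1r opprK xn.
by rewrite xn ltnSn scale1r.
Qed.

Lemma tbasis_simple_add b :
  exists a, simple_root R a = tbasis b ord_penult + tbasis b ord_max.
Proof.
have [|a aE] := @tbasis_simple_sub (~~ b) ord_penult ord_max.
  by rewrite val_penult.
exists a; rewrite aE (tbasis_sign _ b) (tbasis_sign (~~ b) b ord_max).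
rewrite eqxx andbT addNb addbb scaleN1r opprK.
have /negbTE-> : ord_penult != ord_max by rewrite neq_ord_max val_penult.
by rewrite andbF scale1r.
Qed.

Lemma pos_simple_root a : pos_roots R n.+2 (simple_root R a).
Proof.
have [b [x [y [yx ->]]]] := simple_root_tbasis a.
by apply: pos_root_sub; rewrite yx.
Qed.

Definition in_cone v := exists c : I -> nat, v = \sum_a simple_root R a *+ c a.

Lemma in_cone0 : in_cone 0.
Proof. by exists (fun=> 0%N); rewrite big1. Qed.

Lemma in_coneD v w : in_cone v -> in_cone w -> in_cone (v + w).
Proof.
move=> [c ->] [d ->]; exists (fun a => (c a + d a)%N).
by rewrite -big_split /=; apply: eq_bigr => a _; rewrite mulrnDr.
Qed.

Lemma in_cone_simple a : in_cone (simple_root R a).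
Proof.
exists (fun k => (k == a : nat)); rewrite (bigD1 a) //= eqxx mulr1n big1 ?addr0 //.
by move=> k /negbTE->.
Qed.

Lemma in_cone_sub b x y : (x <= y)%N -> in_cone (tbasis b x - tbasis b y).
Proof.
move=> xy; have [d yE] : exists d, nat_of_ord y = (x + d)%N by exists (y - x)%N; lia.
elim: d y yE {xy} => [|d IHd] y yE.
  have -> : y = x by apply/val_inj; rewrite /= yE addn0.
  by rewrite subrr; exact: in_cone0.
have dy : (x + d < n.+2)%N by have := ltn_ord y; lia.
have {IHd} := IHd (Ordinal dy) erefl.
have [|a aE] := @tbasis_simple_sub b (Ordinal dy) y; first by rewrite yE addnS.
by move=> /in_coneD/(_ (in_cone_simple a)); rewrite aE addrA subrK.
Qed.

(** The excluded vector 2 f_L is a difference of two distinct simple roots, so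
    it lies outside the cone. *)
Lemma in_cone_add b x y : (x != ord_max) || (y != ord_max) ->
  in_cone (tbasis b x + tbasis b y).
Proof.
wlog xL : x y / x != ord_max => [IH|_].
  by move=> /orP[]h; last rewrite addrC; apply: IH; rewrite ?h.
have [a aE] := tbasis_simple_add b.
have xP : (x <= ord_penult)%N by rewrite val_penult -ltnS -neq_ord_max.
have yL : (y <= @ord_max n.+1)%N by rewrite -ltnS.
have := in_coneD (in_cone_sub b xP) (in_coneD (in_cone_sub b yL) (in_cone_simple a)).
rewrite aE; congr in_cone; apply/matrixP => i k; rewrite !mxE; ring.
Qed.

(** These functionals are nonnegative on the simple roots; they detect failures
    of the root order. *)
Definition prefix_sum b m v : R :=
  \sum_(k < n.+2 | (k <= m)%N) (-1) ^+ (b && (k == ord_max)) * v k 0.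

Lemma prefix_sumD b m : {morph prefix_sum b m : v w / v + w}.
Proof. by move=> v w; rewrite -big_split; apply: eq_bigr => k _; rewrite mxE mulrDr. Qed.

Lemma prefix_sumZ b m c v : prefix_sum b m (c *: v) = c * prefix_sum b m v.
Proof. by rewrite mulr_sumr; apply: eq_bigr => k _; rewrite mxE mulrCA. Qed.

Lemma prefix_sumN b m : {morph prefix_sum b m : v / - v}.
Proof. by move=> v; rewrite -scaleN1r prefix_sumZ mulN1r. Qed.

Lemma prefix_sumB b m : {morph prefix_sum b m : v w / v - w}.
Proof. by move=> v w; rewrite prefix_sumD prefix_sumN. Qed.

Lemma prefix_sum_tbasis b m k : prefix_sum b m (tbasis b k) = (k <= m)%N%:R.
Proof.
rewrite /prefix_sum big_mkcond (bigD1 k) //= big1 ?addr0; last first.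
  by move=> i /negbTE ik; rewrite tbasisE ik !mulr0 if_same.
by rewrite tbasisE eqxx mulr1 -signr_addb addbb; case: leqP.
Qed.

Definition prefix_sumE :=
  (prefix_sumB, prefix_sumD, prefix_sumN, prefix_sumZ, prefix_sum_tbasis).

Lemma prefix_sum_pos_root b m v : pos_roots R n.+2 v -> 0 <= prefix_sum b m v.
Proof.
move/(pos_rootsP b) => [i [j [s [ij ->]]]]; rewrite !prefix_sumE.
by case: s; case: (leqP i m); case: (leqP j m) => /=; rewrite ?expr0 ?expr1; lia || lra.
Qed.

Lemma prefix_sum_cone b m v : in_cone v -> 0 <= prefix_sum b m v.
Proof.
move=> [c ->]; elim/big_rec: _ => [|a w _ wge0].
  by rewrite /prefix_sum big1 // => k _; rewrite mxE mulr0.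
rewrite prefix_sumD addr_ge0 // -scaler_nat prefix_sumZ mulr_ge0 ?ler0n //.
exact/prefix_sum_pos_root/pos_simple_root.
Qed.

Lemma pos_root_neg v : pos_roots R n.+2 v -> ~ root_neg v.
Proof.
move=> /(pos_rootsP false)[i [j [s [ij ->]]]] /(prefix_sum_pos_root false i).
by rewrite !prefix_sumE leqnn leqNgt ij /=; lra.
Qed.

Lemma root_dichotomy b i j s t : i != j ->
  root_pos ((-1) ^+ s *: tbasis b i + (-1) ^+ t *: tbasis b j) \/
  root_neg ((-1) ^+ s *: tbasis b i + (-1) ^+ t *: tbasis b j).
Proof.
wlog ij : i j s t / (i < j)%N => [IH ij|_].
  have := ij; rewrite -val_eqE neq_ltn => /orP[]h; first exact: IH.
  by rewrite addrC; apply: IH => //; rewrite eq_sym.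
case: s; last first.
  by left; rewrite scale1r; exact: pos_root_tbasis.
right; rewrite /root_neg scaleN1r opprD opprK -scalerN.
have -> : (-1) ^+ t *: - tbasis b j = (-1) ^+ (~~ t) *: tbasis b j.
  by rewrite signrN scaleNr scalerN.
exact: pos_root_tbasis.
Qed.

End TwistedBasis.

(** * Classification of the rational elements *)

Section Rational.
Variables (R : realType) (n : nat).
Notation I := 'I_n.+2.
Notation V := 'cV[R]_n.+2.
Implicit Types (b s t : bool) (i j k x y m a : I) (v w : V).
Implicit Types (u : 'M[R]_n.+2) (p : 'S_n.+2).
Local Notation tb := (@tbasis R n).
Local Notation L := (@ord_max n.+1).

(** By induction on k, every u v with v in T belongs to nu_k. *)
Lemma trap_not_rational u (T : V -> Prop) :
  (exists v, T v) ->
  (forall v, T v -> [/\ root_pos v, root_pos (u *m v) &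
     exists2 w, T w & in_cone (u *m w - v)]) ->
  ~ rational_elt u.
Proof.
move=> [v0 Tv0] trap [K nuK].
suff nuT (k : nat) v : T v -> nu u k (u *m v) by have := nuT K v0 Tv0; rewrite nuK.
elim: k v => [|k IHk] v Tv; have [vpos uvpos [w Tw vw]] := trap v Tv.
  by split=> //; exists v.
by split=> //; exists v => //; split=> //; exists (u *m w); [exact: IHk|exact: vw].
Qed.

Lemma fixed_trap u v : rational_elt u ->
  root_pos v -> root_pos (u *m v) -> in_cone (u *m v - v) -> False.
Proof.
move=> ratu vpos uvpos vle; apply: (@trap_not_rational u (eq v)) ratu.
  by exists v.
by move=> _ <-; split=> //; exists v.
Qed.

(** With the sign of f_L absorbed in [b], this is, for r odd, the shape
    of all rational elements of W(D_r); p = 1 gives the longest element. *)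
Definition opposite_rise b p u :=
  [/\ forall k, k != L -> u *m tb b k = - tb b (p k),
      u *m tb b L = tb b (p L) &
      forall k, k != L -> (k <= p k)%N].

Section Descent.
Variables (b : bool) (p : 'S_n.+2) (u : 'M[R]_n.+2).
Hypothesis up : opposite_rise b p u.

Lemma neq_max_lt i j : (i < j)%N -> i != L.
Proof. by move=> ij; rewrite neq_ord_max (leq_trans ij) // -ltnS. Qed.

(** The only positive roots with positive image are f_i - f_j with j < L and
    p j < p i, and some f_i + f_L; the coordinate sum, 0 and 2, separates the
    two families, whereas the images have coordinate sum 0 in both. *)
Lemma opposite_rise_pos v : root_pos v -> root_pos (u *m v) ->
  prefix_sum b L (u *m v) <= 0 /\
  (prefix_sum b L v <= 0 -> exists i j,
    [/\ (i < j)%N, j != L, (p j < p i)%N, v = tb b i - tb b j &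
        u *m v = tb b (p j) - tb b (p i)]).
Proof.
case: up => uf ufL _.
move=> /(pos_rootsP b)[i [j [s [ij ->]]]].
have := neq_max_lt ij => iL.
rewrite mulmxDr uf // -scalemxAr => uvpos.
have := prefix_sum_pos_root b L uvpos.
have := prefix_sum_pos_root b (p i) uvpos.
have [jL|jL] := eqVneq j L.
  rewrite jL ufL !prefix_sumE !le_ord_max /=.
  by case: s uvpos => uvpos; rewrite ?expr0 ?expr1; split; lra.
rewrite uf // !prefix_sumE leqnn !le_ord_max /=.
case: s uvpos => uvpos; rewrite /= ?expr0 ?expr1; last by lra.
case: leqP => [pji|_]; last by rewrite /=; lra.
move=> _ _; split=> [|_]; first by lra.
exists i, j; split=> //; last by rewrite scaleN1r opprK addrC.
  rewrite ltn_neqAle pji andbT; apply: contraTneq ij => /val_inj/perm_inj->.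
  by rewrite ltnn.
by rewrite scaleN1r.
Qed.

Lemma opposite_rise_rational : rational_elt u.
Proof.
have [_ _ le_p] := up.
suff nu2 : nu u 2 = classical_sets.set0.
  exists 2; elim=> [|[|[|k]]] // IHk _.
  rewrite -[nu u k.+3]/(((mulmx u) @` Adj (nu u k.+2)) `&` pos_roots R n.+2)%classic.
  rewrite IHk // -subset0 => v [[w [_ [? []]]]].
rewrite -subset0 => uv0 [[v0 [v0pos [uv1 nu1 v0le]] uv0E] uv0pos].
case: nu1 => [[v1 [v1pos [uv2 nu0 v1le]] uv1E] uv1pos].
case: nu0 => [[v2 v2pos uv2E] uv2pos]; rewrite -{}uv0E -{}uv1E -{}uv2E in
  uv0pos uv1pos uv2pos v0le v1le.
have [uv2sum _] := opposite_rise_pos v2pos uv2pos.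
have [uv1sum v1E] := opposite_rise_pos v1pos uv1pos.
have [_ v0E] := opposite_rise_pos v0pos uv0pos.
(* v1 and v0 lie below images, hence have coordinate sum at most 0. *)
have := prefix_sum_cone b L v1le; rewrite prefix_sumB => v1sum.
have := prefix_sum_cone b L v0le; rewrite prefix_sumB => v0sum.
have [|i [j [ij jL pji _ uv1E]]] := v1E; first by lra.
have [|x [y [xy yL pyx v0eq _]]] := v0E; first by lra.
(* v0 = f_x - f_y <= f_(p j) - f_(p i) puts x between p j and p i. *)
have := prefix_sum_cone b x v0le.
rewrite uv1E v0eq !prefix_sumE leqnn (leqNgt y) xy /=.
case: leqP => [pjx|_]; case: leqP => [_|xpi] /=; [lra| |lra|lra].
move=> _; have := perm_rise_gap le_p (neq_max_lt ij) _ xpi => px.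
have : p x = x by apply: px; rewrite (leq_trans ij) // (leq_trans (le_p j jL)).
by move=> pxx; have := le_p y yL; rewrite leqNgt (ltn_trans pyx) // pxx.
Qed.

End Descent.

Definition signed_perm (neg : I -> bool) p u :=
  forall k, u *m tb false k = (-1) ^+ neg k *: tb false (p k).

Section Classification.
Variables (neg : I -> bool) (p : 'S_n.+2) (u : 'M[R]_n.+2).
Hypothesis (up : signed_perm neg p u) (ratu : rational_elt u).
Local Notation e := (tb false).

Lemma up_plus k : ~~ neg k -> u *m e k = e (p k).
Proof. by rewrite up => /negbTE->; rewrite scale1r. Qed.

Lemma up_minus k : neg k -> u *m e k = - e (p k).
Proof. by rewrite up => ->; rewrite scaleN1r. Qed.

Lemma in_cone_eq v w : in_cone v -> v = w -> in_cone w.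
Proof. by move=> ? <-. Qed.

Lemma perm_neq i j : (i < j)%N -> p i != p j.
Proof. by move=> ij; rewrite (inj_eq perm_inj) -val_eqE ltn_eqF. Qed.

(** If e_j goes to e_(p j) with p j <= j < L, one of e_j - e_L, e_j + e_L is
    sent weakly above itself, unless u e_L = - e_L; then u sends each of the two
    weakly above the other. *)
Lemma plus_rises j : ~~ neg j -> j != L -> (j < p j)%N.
Proof.
move=> jplus jL; rewrite ltnNge; apply/negP => pjj.
have jltL : (j < L)%N by rewrite -neq_ord_max.
have pne := perm_neq jltL.
have jnL : p j != L by rewrite neq_ord_max (leq_ltn_trans pjj) -?neq_ord_max.
have [Lminus|Lplus] := boolP (neg L); last first.
  apply: (fixed_trap ratu (pos_root_add R false (negbT (ltn_eqF jltL)))).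
    by rewrite mulmxDr !up_plus //; apply: pos_root_add.
  rewrite mulmxDr !up_plus // opprD addrACA.
  by apply: in_coneD; apply: in_cone_sub; rewrite // -ltnS.
have [pL|pL] := eqVneq (p L) L; last first.
  apply: (fixed_trap ratu (pos_root_sub R false jltL)).
    by rewrite mulmxBr up_plus // up_minus // opprK; apply: pos_root_add.
  rewrite mulmxBr up_plus // up_minus // !opprK opprD opprK addrACA.
  by apply: in_coneD; [exact: in_cone_sub|apply: in_cone_add; rewrite pL].
have pltL : (p j < L)%N by rewrite -neq_ord_max.
apply: (@trap_not_rational u (fun v => exists s, v = e j + (-1) ^+ s *: e L)) ratu.
  by eexists; exists false.
move=> _ [s ->].
have uE t : u *m (e j + (-1) ^+ t *: e L) = e (p j) + (-1) ^+ (~~ t) *: e L.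
  by rewrite mulmxDr up_plus // -scalemxAr up_minus // pL signrN scalerN scaleNr.
split; rewrite ?uE; [exact: pos_root_tbasis|exact: pos_root_tbasis|].
exists (e j + (-1) ^+ (~~ s) *: e L); first by exists (~~ s).
rewrite uE negbK opprD addrACA subrr addr0; exact: in_cone_sub.
Qed.

(** Let k > j.  If the sign at k is negative and p k <= j, then e_j - e_k is
    sent weakly above itself, unless k = p j = L; if the sign is positive and
    k < L, then j < k < p k by [plus_rises].  If p k > j held at k = L too, p
    would send [j, L] into (j, L]. *)
Lemma plus_low_max j : ~~ neg j -> j != L ->
  (p L <= j)%N /\ (~~ neg L \/ p j = L).
Proof.
move=> jplus jL; have pj := plus_rises jplus jL.

have above k : (j <= k)%N -> (k != L) || neg L && (p j != L) -> (j < p k)%N.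
  rewrite leq_eqVlt => /orP[/eqP/val_inj<-//|jk] kL.
  have [kminus|kplus] := boolP (neg k); last first.
    apply: (leq_trans jk); apply/ltnW/plus_rises => //.
    by case/orP: kL => // /andP[Lm _]; apply: contraNneq kplus => ->.
  rewrite ltnNge; apply/negP => pkj.
  apply: (fixed_trap ratu (pos_root_sub R false jk)).
    rewrite mulmxBr up_plus // up_minus // opprK; exact/pos_root_add/perm_neq.
  rewrite mulmxBr up_plus // up_minus // !opprK addrC.
  have c1 := in_cone_sub R false pkj.
  have c2 : in_cone (e (p j) + e k).
    by apply: in_cone_add; case/orP: kL => [->|/andP[_ ->]]; rewrite ?orbT.
  apply: in_cone_eq (in_coneD c1 c2) _; apply/matrixP => ? ?; rewrite !mxE; ring.
have all_above : (j < p L)%N -> False.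
  move=> pLj; apply: (@perm_no_miss _ p [set k : I | j <= k]%N j).
    by rewrite inE.
  move=> k; rewrite !inE => jk.
  have jpk : (j < p k)%N by have [->|kL] := eqVneq k L; last by apply: above; rewrite ?kL.
  by rewrite (ltnW jpk) -val_eqE gtn_eqF.
split; first by rewrite leqNgt; apply/negP.
have [Lminus|] := boolP (neg L); last by left.
right; apply/eqP/negPn/negP => pjL; apply/all_above/above; first exact: le_ord_max.
by rewrite Lminus pjL orbT.
Qed.

(** Otherwise e_j + e_L would be sent weakly above itself. *)
Lemma plus_max_unique j : ~~ neg L -> j != L -> neg j.
Proof.
move=> Lplus jL; apply/negPn/negP => jplus.
have [pLj _] := plus_low_max jplus jL.
have jltL : (j < L)%N by rewrite -neq_ord_max.
apply: (fixed_trap ratu (pos_root_add R false (negbT (ltn_eqF jltL)))).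
  by rewrite mulmxDr !up_plus //; exact/pos_root_add/perm_neq.
rewrite mulmxDr !up_plus // [e (p j) + _]addrC opprD addrACA.
by apply: in_coneD; apply: in_cone_sub; rewrite // -ltnS.
Qed.

(** If the sign at L is positive it is the only positive one and f = e.  If it
    is negative, the only positive sign is at the index sent to L, and f_L = - e_L
    turns both exceptional signs around. *)
Lemma rational_twist : (exists j, ~~ neg j) -> exists b,
  (forall k, k != L -> u *m tb b k = - tb b (p k)) /\ u *m tb b L = tb b (p L).
Proof.
move=> [j jplus]; have [Lminus|Lplus] := boolP (neg L); last first.
  exists false; split=> [k kL|]; last exact: up_plus.
  exact/up_minus/plus_max_unique.
have plusP k : ~~ neg k -> p k = L /\ (p L < L)%N.
  move=> kplus; have kL : k != L by apply: contraNneq kplus => ->.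
  have [pLk [|pk]] := plus_low_max kplus kL; first by rewrite Lminus.
  by split=> //; rewrite (leq_ltn_trans pLk) -?neq_ord_max.
have [pj pL] := plusP j jplus.
have twL : tb true L = - e L by rewrite (tbasis_sign _ _ false) eqxx scaleN1r.
have tw k : k != L -> tb true k = e k by move=> kL; rewrite !tbasis_neq_max.
exists true; split=> [k kL|]; last first.
  by rewrite twL mulmxN up_minus // opprK tw // neq_ord_max.
rewrite tw //; have [kminus|kplus] := boolP (neg k).
  rewrite up_minus // tw // -pj (inj_eq perm_inj).
  by apply: contraNneq jplus => <-.
by rewrite up_plus //; have [-> _] := plusP k kplus; rewrite twL opprK.
Qed.

(** When p j <= i < j <= p i with j < L, the image of f_i - f_j is
    f_(p j) - f_(p i), which lies weakly above it. *)
Lemma rational_opposite_rise : (exists j, ~~ neg j) -> exists b, opposite_rise b p u.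
Proof.
move=> /rational_twist[b [uf ufL]]; exists b; split=> //.
apply: perm_no_cross_rise => i j ij jL pji; rewrite ltnNge; apply/negP => jpi.
have iL := neq_max_lt ij.
apply: (fixed_trap ratu (pos_root_sub R b ij)).
  rewrite mulmxBr !uf // opprK addrC; apply: pos_root_sub.
  by rewrite (leq_ltn_trans pji) // (leq_trans ij).
rewrite mulmxBr !uf //.
apply: in_cone_eq (in_coneD (in_cone_sub R b pji) (in_cone_sub R b jpi)) _.
by apply/matrixP => ? ?; rewrite !mxE; ring.
Qed.

End Classification.
End Rational.

(** * Simple reflections and the choice of the simple root *)

Section Reflections.
Variables (R : realType) (n : nat).
Notation I := 'I_n.+2.
Notation V := 'cV[R]_n.+2.
Implicit Types (b s t : bool) (i j k x y m a : I) (v w : V).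
Implicit Types (u : 'M[R]_n.+2) (p : 'S_n.+2) (neg : I -> bool).
Local Notation tb := (@tbasis R n).
Local Notation e := (@tbasis R n false).
Local Notation L := (@ord_max n.+1).

Lemma reflection_mulmx v w :
  reflection_mx v *m w = w - (2 / dotv v v * dotv v w) *: v.
Proof.
rewrite mulmxBl mul1mx -scalemxAl -mulmxA.
have -> : v^T *m w = (dotv v w)%:M.
  apply/matrixP => i j; rewrite !ord1 !mxE eqxx mulr1n.
  by apply: eq_bigr => k _; rewrite mxE.
by rewrite mul_mx_scalar scalerA.
Qed.

Lemma dotv_tbasis b i v :
  dotv v (tb b i) = v i 0 * (-1) ^+ (b && (i == L)).
Proof.
rewrite /dotv (bigD1 i) //= big1 ?addr0 => [|k /negbTE ki].
  by rewrite tbasisE eqxx mulr1.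
by rewrite tbasisE ki !mulr0.
Qed.

Lemma dotvBr v w w' : dotv v (w - w') = dotv v w - dotv v w'.
Proof.
by rewrite /dotv -sumrB; apply: eq_bigr => k _; rewrite !mxE mulrBr.
Qed.

Lemma dotv_tbasisB b x y k :
  dotv (tb b x - tb b y) (tb b k) = (x == k)%:R - (y == k)%:R.
Proof.
have tbk z : tb b z k 0 * (-1) ^+ (b && (k == L)) = (z == k)%:R.
  rewrite tbasisE mulrAC; have [->|_] := eqVneq z k; last by rewrite mulr0.
  by rewrite mulr1 -signr_addb addbb.
have kE : (tb b x - tb b y) k 0 = tb b x k 0 - tb b y k 0 by rewrite !mxE.
by rewrite dotv_tbasis kE mulrBl !tbk.
Qed.

Lemma simple_refl_tbasis b a x y k :
  x != y -> simple_root R a = tb b x - tb b y ->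
  simple_refl R a *m tb b k = tb b (tperm x y k).
Proof.
move=> xy aE; rewrite /simple_refl reflection_mulmx aE dotvBr !dotv_tbasisB.
rewrite !eqxx (negbTE xy) (eq_sym y) (negbTE xy) subr0 sub0r opprK.
rewrite divff ?pnatr_eq0 // mul1r.
case: tpermP => [->|->|/eqP kx /eqP ky].
- by rewrite eqxx eq_sym (negbTE xy) subr0 scale1r opprB addrC subrK.
- by rewrite eqxx (negbTE xy) sub0r scaleN1r opprK addrC subrK.
by rewrite eq_sym (negbTE kx) eq_sym (negbTE ky) subrr scale0r subr0.
Qed.

Lemma adjacent_neq x y : y = x.+1 :> nat -> x != y.
Proof. by move=> yx; rewrite -val_eqE /= yx ltn_eqF. Qed.

Lemma simple_refl_root a : simple_refl R a *m simple_root R a = - simple_root R a.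
Proof.
have [b [x [y [yx aE]]]] := simple_root_tbasis R a.
rewrite aE mulmxBr !(simple_refl_tbasis _ (adjacent_neq yx) aE).
by rewrite tpermL tpermR opprB.
Qed.

Lemma simple_reflK a : simple_refl R a *m simple_refl R a = 1%:M.
Proof.
have [b [x [y [yx aE]]]] := simple_root_tbasis R a.
apply: (@mulmx_tbasis_ext R n b) => k.
by rewrite -mulmxA !(simple_refl_tbasis _ (adjacent_neq yx) aE) tpermK mul1mx.
Qed.

Lemma tperm_adjacent_lt x y i j : y = x.+1 :> nat -> (i < j)%N ->
  (i, j) != (x, y) -> (tperm x y i < tperm x y j)%N.
Proof.
move=> yx ij; rewrite xpair_eqE -!val_eqE /= => ijxy.
do 2![case: tpermP => [/(congr1 val)|/(congr1 val)|/eqP + /eqP +];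
  rewrite -?val_eqE /= => *]; lia.
Qed.

Lemma simple_refl_pos_root a v : pos_roots R n.+2 v -> v <> simple_root R a ->
  pos_roots R n.+2 (simple_refl R a *m v).
Proof.
have [b [x [y [yx aE]]]] := simple_root_tbasis R a.
move=> /(pos_rootsP b)[i [j [s [ij ->]]]]; rewrite aE => vE.
rewrite mulmxDr -scalemxAr !(simple_refl_tbasis _ (adjacent_neq yx) aE).
have [[ix jy]|ne] := eqVneq (i, j) (x, y); last first.
  exact/pos_root_tbasis/tperm_adjacent_lt.
move: vE; rewrite ix jy tpermL tpermR; case: s => vE.
  by case: vE; rewrite scaleN1r.
by rewrite scale1r; apply: pos_root_add; rewrite eq_sym adjacent_neq.
Qed.

Lemma opposite_rise_longest b p u : opposite_rise b p u -> p L = L ->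
  u = longest_elt R n.+2.
Proof.
move=> [uf ufL le_p] pL.
have p1 : p = 1%g.
  by apply: perm_ge_id => k; have [->|/le_p//] := eqVneq k L; rewrite pL.
apply: (@mulmx_tbasis_ext R n b) => k.
have -> : longest_elt R n.+2 *m tb b k = (if k == L then 1 else -1) *: tb b k.
  apply/matrixP => i j; rewrite mul_diag_mx !mxE ltnS -neq_ord_max.
  by case: (eqVneq i k) => [->|_]; rewrite ?mulr0 //; case: eqP.
by case: eqP => [->|/eqP kL]; rewrite ?ufL ?uf // p1 perm1 ?scale1r ?scaleN1r.
Qed.

(** The indices x < y are the two values exchanged.  By [perm_rise_gap], x is
    either i = p L or fixed by p; accordingly the simple root f_x - f_y is the
    image of f_L + f_i or of f_i - f_x. *)
Lemma opposite_rise_step b p u : u \in unitmx -> opposite_rise b p u -> p L != L ->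
  exists a, [/\ root_pos (invmx u *m simple_root R a),
                root_neg (u *m simple_root R a) &
                exists q, opposite_rise b q (simple_refl R a *m u)].
Proof.
move=> uU [uf ufL le_p] pLL; set i := p L; set y := p i.
have iy : (i < y)%N.
  rewrite ltn_neqAle le_p // andbT val_eqE; apply: contraNneq pLL => iy.
  exact/eqP/(@perm_inj _ p)/esym.
have x_lt : (y.-1 < n.+2)%N by rewrite (leq_ltn_trans (leq_pred y)).
pose x : I := Ordinal x_lt.
have yx : y = x.+1 :> nat by rewrite /= prednK // (leq_trans _ iy).
have ix : (i <= x)%N by rewrite -ltnS -yx.
have xL : x != L by rewrite neq_ord_max -ltnS -yx.
have px : x != i -> p x = x.
  move=> xi; apply: (perm_rise_gap (i := i)) => //; last by rewrite -/y yx.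
  by rewrite ltn_neqAle eq_sym val_eqE xi.
have [a aE] := tbasis_simple_sub R b yx; exists a; split.
- have [w wpos wE] : exists2 w, root_pos w & u *m w = simple_root R a.
    have [xi|xi] := eqVneq x i.
      exists (tb b L + tb b i); first by apply: pos_root_add; rewrite eq_sym.
      by rewrite mulmxDr ufL uf // -/i -/y aE xi.
    exists (tb b i - tb b x).
      by apply: pos_root_sub; rewrite ltn_neqAle eq_sym val_eqE xi.
    by rewrite mulmxBr !uf // -/y px // opprK addrC aE.
  by rewrite -wE mulKmx.
- rewrite /root_neg aE mulmxBr uf // opprB opprK addrC.
  have pxy : (p x <= y)%N.
    by have [->//|/px->] := eqVneq x i; rewrite yx.
  have [yL|yL] := eqVneq y L.
    by rewrite yL ufL; apply: pos_root_add; rewrite (inj_eq perm_inj).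
  rewrite uf //; apply/pos_root_sub/(leq_ltn_trans pxy).
  rewrite ltn_neqAle le_p // andbT val_eqE; apply: contraTneq iy.
  by move=> /(@perm_inj _ p i y)->; rewrite ltnn.
exists (p * tperm x y)%g.
have refl k := simple_refl_tbasis k (adjacent_neq yx) aE.
split=> [k kL||k kL]; rewrite -?mulmxA ?permM.
- by rewrite uf // mulmxN refl.
- by rewrite ufL refl.
case: tpermP => [pk|pk|_ _]; last exact: le_p.
  by rewrite yx ltnW // ltnS -pk le_p.
by rewrite (perm_inj pk).
Qed.

(** * Coxeter length *)

Definition pos_root_seq : seq V :=
  undup [seq e z.1.1 + (-1) ^+ z.2 *: e z.1.2 |
           z : I * I * bool <- enum {: I * I * bool} & (z.1.1 < z.1.2)%N].

Lemma mem_pos_root_seq v : reflect (pos_roots R n.+2 v) (v \in pos_root_seq).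
Proof.
apply: (iffP idP); rewrite mem_undup.
  by move=> /mapP[[[i j] s]]; rewrite mem_filter => /andP[ij _] ->; exact: pos_root_tbasis.
move=> /(pos_rootsP false)[i [j [s [ij ->]]]].
by apply/mapP; exists (i, j, s); rewrite // mem_filter ij mem_enum.
Qed.

Definition inversions u : nat :=
  count (fun v => `[< root_neg (invmx u *m v) >]) pos_root_seq.

Lemma invmx_simple_refl a u : u \in unitmx ->
  (simple_refl R a *m u \in unitmx) /\
  invmx (simple_refl R a *m u) = invmx u *m simple_refl R a.
Proof.
move=> uU; have [sU _] := mulmx1_unit (simple_reflK a).
have suU : simple_refl R a *m u \in unitmx by rewrite unitmx_mul sU.
split=> //; rewrite -[RHS](mulmxK suU) mulmxA -(mulmxA (invmx u)).
by rewrite simple_reflK mulmx1 mulVmx // mul1mx.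
Qed.

(** The reflection permutes the positive roots other than its own, which
    contribute the same number [c] to both sides, and reverses its own. *)
Lemma inversions_simple_refl a u : u \in unitmx ->
  exists c, inversions u = (`[< root_neg (invmx u *m simple_root R a) >] + c)%N /\
    inversions (simple_refl R a *m u) =
      (`[< root_pos (invmx u *m simple_root R a) >] + c)%N.
Proof.
move=> uU; pose S := rem (simple_root R a) pos_root_seq.
have Suniq : uniq S by rewrite rem_uniq // undup_uniq.
have memS v : v \in S = (v != simple_root R a) && (v \in pos_root_seq).
  by rewrite mem_rem_uniq ?undup_uniq // inE.
have rootsE : perm_eq pos_root_seq (simple_root R a :: S).
  exact/perm_to_rem/mem_pos_root_seq/pos_simple_root.
have reflS : perm_eq (map (mulmx (simple_refl R a)) S) S.
  have reflU : uniq (map (mulmx (simple_refl R a)) S).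
    rewrite map_inj_uniq // => v w /(congr1 (mulmx (simple_refl R a))).
    by rewrite !mulmxA simple_reflK !mul1mx.
  apply: uniq_perm => //.
  apply: (uniq_min_size reflU _ _).2; last by rewrite size_map.
  move=> _ /mapP[v + ->]; rewrite !memS => /andP[/eqP va /mem_pos_root_seq vpos].
  apply/andP; split; last exact/mem_pos_root_seq/simple_refl_pos_root.
  apply/eqP => /(congr1 (mulmx (simple_refl R a))).
  rewrite mulmxA simple_reflK mul1mx simple_refl_root => vE.
  have := pos_root_neg vpos; rewrite vE /root_neg opprK; apply.
  exact: pos_simple_root.
exists (count (fun v => `[< root_neg (invmx u *m v) >]) S); split.
  by rewrite /inversions (seq.permP rootsE).
rewrite /inversions (seq.permP rootsE) /=; have [_ ->] := invmx_simple_refl a uU.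
congr (_ + _)%N.
  by rewrite -mulmxA simple_refl_root mulmxN /root_neg opprK.
rewrite -[RHS](seq.permP reflS) count_map; apply: eq_count => v /=.
by rewrite mulmxA.
Qed.

Lemma inversions1 : inversions 1%:M = 0%N.
Proof.
apply/eqP; rewrite -leqn0 leqNgt -has_count; apply/hasPn => v.
by move=> /mem_pos_root_seq/pos_root_neg/asboolPn; rewrite invmx1 mul1mx.
Qed.

Lemma inversions_word (w : seq I) :
  (word_mx R w \in unitmx) /\ (inversions (word_mx R w) <= size w)%N.
Proof.
elim: w => [|a w [wU IHw]] /=.
  by rewrite inversions1 unitmx1.
have [suU _] := invmx_simple_refl a wU; split=> //.
have [c [cE ->]] := inversions_simple_refl a wU.
by rewrite (leq_add (leq_b1 _)) // (leq_trans _ IHw) // cE leq_addl.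
Qed.

Lemma signed_perm_unit neg p u : signed_perm neg p u -> u \in unitmx.
Proof.
move=> up; suff /mulmx1_unit[_ ->] : u^T *m u = 1%:M by [].
have uE i j : u i j = (-1) ^+ neg j * (i == p j)%:R.
  have := up j; rewrite tbasis_false basis_vec_delta.
  by rewrite -colE => /matrixP/(_ i 0); rewrite mxE => ->; rewrite mxE tbasisE mul1r.
apply/matrixP => j k; rewrite !mxE (bigD1 (p j)) //= big1 ?addr0; last first.
  by move=> i /negbTE ij; rewrite mxE !uE ij mulr0 mul0r.
rewrite mxE !uE eqxx mulr1 (inj_eq perm_inj); case: eqP => [->|]; last by rewrite !mulr0.
by rewrite mulr1 -signr_addb addbb.
Qed.

Lemma signed_perm_inv neg p u : signed_perm neg p u ->
  signed_perm (fun k => neg ((p^-1)%g k)) (p^-1)%g (invmx u).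
Proof.
move=> up k; have uU := signed_perm_unit up.
rewrite -[LHS]scale1r -{1}(expr1n _ 0) -[in LHS](permKV p k).
set j := (p^-1)%g k.
have -> : e (p j) = (-1) ^+ neg j *: (u *m e j).
  by rewrite up scalerA -signr_addb addbb scale1r.
by rewrite -scalemxAr mulKmx // expr0 scale1r.
Qed.

Lemma odd_card_xor neg : odd #|[set j | neg j]%SET| = \big[addb/false]_j neg j.
Proof.
rewrite -sum1_card big_mkcond /= (big_morph odd oddD erefl).
by apply: eq_bigr => j _; rewrite inE; case: (neg j).
Qed.

(** Multiplying by a reflection changes sign exactly at the indices sent to L
    before and after, and only when the sign of f_L is twisted: an even
    number. *)
Lemma signed_perm_simple_refl a neg p u :
  signed_perm neg p u -> ~~ odd #|[set j | neg j]%SET| ->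
  exists neg' p', signed_perm neg' p' (simple_refl R a *m u) /\
    ~~ odd #|[set j | neg' j]%SET|.
Proof.
move=> up par; have [b [x [y [yx aE]]]] := simple_root_tbasis R a.
pose flips (q : 'S_n.+2) j := b && (q j == L).
exists (fun j => neg j (+) (flips p j (+) flips (p * tperm x y)%g j)).
exists (p * tperm x y)%g; split=> [k|].
  rewrite -mulmxA up -scalemxAr (tbasis_sign R false b) -scalemxAr.
  rewrite (simple_refl_tbasis _ (adjacent_neq yx) aE) (tbasis_sign R b false).
  by rewrite !scalerA -!signr_addb /flips /= !permM addbF addbA.
have flipsE q : \big[addb/false]_j flips q j = b.
  rewrite (bigD1 ((q^-1)%g L)) //= /flips permKV eqxx andbT big1 ?addbF //.
  by move=> j jL; rewrite -(inj_eq (@perm_inj _ (q^-1)%g)) permK (negbTE jL) andbF.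
by rewrite odd_card_xor !big_split /= !flipsE addbb addbF -odd_card_xor.
Qed.

Lemma prefix_sum_mulmx_cone b m u v :
  (forall a, root_pos (u *m simple_root R a)) -> in_cone v ->
  0 <= prefix_sum b m (u *m v).
Proof.
move=> upos [c ->]; rewrite mulmx_sumr.
elim/big_rec: _ => [|a w _ wge0]; first by rewrite -(scale0r 0) prefix_sumZ mul0r.
rewrite prefix_sumD addr_ge0 // -scaler_nat -scalemxAr prefix_sumZ.
by rewrite mulr_ge0 ?ler0n //; exact/prefix_sum_pos_root/upos.
Qed.

(** For k < L the vector 2 e_k is a sum of simple roots, so its image has
    nonnegative coordinate sum; this gives the signs, and then the images of
    f_x - f_y show that p is increasing.  The sign at L is not determined, since
    the reflection in e_L preserves the positive roots. *)
Lemma signed_perm_dominant neg p u : signed_perm neg p u ->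
  (forall a, root_pos (u *m simple_root R a)) ->
  p = 1%g /\ (forall k, k != L -> ~~ neg k).
Proof.
move=> up upos.
have plus k : k != L -> ~~ neg k.
  move=> kL; have kk : in_cone (e k + e k) by apply: in_cone_add; rewrite kL.
  have := prefix_sum_mulmx_cone false L upos kk.
  rewrite mulmxDr up prefix_sumD prefix_sumZ prefix_sum_tbasis le_ord_max.
  by case: (neg k) => //=; lra.
split=> //; apply: perm_increasing_id => x y xy.
pose b := neg L.
have uE k : u *m tb b k = e (p k).
  have [->|kL] := eqVneq k L; last first.
    by rewrite tbasis_neq_max // -tbasis_false up (negbTE (plus k kL)) scale1r.
  rewrite (tbasis_sign R b false) eqxx addbF andbT -scalemxAr up scalerA.
  by rewrite -signr_addb addbb scale1r.
have := prefix_sum_mulmx_cone false (p y) upos (in_cone_sub R b (ltnW xy)).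
rewrite mulmxBr !uE !prefix_sumE leqnn ltn_neqAle (inj_eq val_inj) (inj_eq perm_inj).
rewrite -val_eqE /= ltn_eqF //=; case: leqP => //= _; lra.
Qed.

(** As long as some simple root has a negative inverse image, its reflection
    removes one inversion; otherwise u is the identity, and here the parity of
    the number of signs settles the sign at L. *)
Lemma inversions_has_word neg p u : signed_perm neg p u ->
  ~~ odd #|[set j | neg j]%SET| -> has_word u (inversions u).
Proof.
have [d] := ubnP (inversions u); elim: d neg p u => // d IHd neg p u.
rewrite ltnS => led up par; have uU := signed_perm_unit up.
have uVp := signed_perm_inv up.
have [allpos|] := pselect (forall a, root_pos (invmx u *m simple_root R a)).
  have [/eqP + negP] := signed_perm_dominant uVp allpos.
  rewrite invg_eq1 => /eqP p1.
  have neg0 k : neg k = false.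
    have negk j : j != L -> neg j = false.
      by move=> jL; have := negP (p j); rewrite permK p1 perm1 => /(_ jL)/negbTE.
    have [->|/negk//] := eqVneq k L; apply: negbTE.
    move: par; rewrite odd_card_xor (bigD1 L) //= big1 ?addbF //.
  have -> : u = 1%:M.
    by apply: (@mulmx_tbasis_ext R n false) => k; rewrite up neg0 p1 perm1 scale1r mul1mx.
  by rewrite inversions1; apply/existsP; exists [tuple].
move/existsNP => [a npos].
have neg_a : root_neg (invmx u *m simple_root R a).
  have /(pos_rootsP false)[i [j [s [ij aE]]]] := pos_simple_root R a.
  move: npos; rewrite aE mulmxDr -scalemxAr !uVp scalerA -signr_addb.
  case: (@root_dichotomy R n false ((p^-1)%g i) ((p^-1)%g j)
           (neg ((p^-1)%g i)) (s (+) neg ((p^-1)%g j))) => //.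
  by rewrite (inj_eq perm_inj) -val_eqE ltn_eqF.
have [c [uE suE]] := inversions_simple_refl a uU.
rewrite (asboolT neg_a) in uE; rewrite (asboolF npos) in suE.
have [neg' [p' [sup par']]] := signed_perm_simple_refl a up par.
have := IHd _ _ _ _ sup par'; rewrite suE -ltnS => /(_ _).
rewrite uE in led *; move=> /(_ led)/existsP[w /eqP wE].
apply/existsP; exists [tuple of a :: w]; apply/eqP.
by rewrite /= -wE mulmxA simple_reflK mul1mx.
Qed.

Lemma coxeter_length_inversions neg p u : signed_perm neg p u ->
  ~~ odd #|[set j | neg j]%SET| -> coxeter_length u = inversions u.
Proof.
move=> up par; have uw := inversions_has_word up par.
rewrite /coxeter_length; case: pselect => [h|[]]; last by exists (inversions u).
case: ex_minnP => d /existsP[w /eqP uE] dmin; apply/eqP.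
rewrite eqn_leq dmin //= uE; have [_] := inversions_word w.
by rewrite size_tuple.
Qed.

Lemma coxeter_length_simple_refl a neg p u : signed_perm neg p u ->
  ~~ odd #|[set j | neg j]%SET| -> root_pos (invmx u *m simple_root R a) ->
  coxeter_length (simple_refl R a *m u) = (coxeter_length u).+1.
Proof.
move=> up par apos; have [neg' [p' [sup par']]] := signed_perm_simple_refl a up par.
rewrite (coxeter_length_inversions sup) // (coxeter_length_inversions up) //.
have [c [-> ->]] := inversions_simple_refl a (signed_perm_unit up).
by rewrite (asboolT apos) (asboolF (pos_root_neg apos)).
Qed.

End Reflections.

Theorem lemma2p6 (R : realType) (r : nat) (r_ge5 : (5 <= r)%N) (r_odd : odd r)
    (u : 'M[R]_r) (uW : in_WD u) (u_rat : rational_elt u)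
    (u_neq_w0 : u <> longest_elt R r) :
  exists a : 'I_r,
    [/\ root_pos (invmx u *m simple_root R a),
        root_neg (u *m simple_root R a),
        rational_elt (simple_refl R a *m u) &
        coxeter_length (simple_refl R a *m u) = (coxeter_length u).+1].
Proof.
case: r r_ge5 r_odd u uW u_rat u_neq_w0 => [|[|n]] // _ r_odd u.
move=> [p [neg [par uE]]] u_rat u_neq_w0.
have up : signed_perm neg p u by move=> k; rewrite !tbasis_false uE.
(* All r signs negative would be an odd number of them. *)
have [j jplus] : exists j, ~~ neg j.
  apply/existsP; rewrite -negb_forall; apply: contraNN par => /forallP allneg.
  suff -> : [set j | neg j]%SET = [set: 'I_n.+2]%SET by rewrite cardsT card_ord.
  by apply/setP => j; rewrite !inE allneg.
have [|b urise] := rational_opposite_rise up u_rat; first by exists j.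
have pL : p ord_max != ord_max.
  by apply/eqP => pL; exact/u_neq_w0/(opposite_rise_longest urise).
have [a [apos aneg [q surise]]] := opposite_rise_step (signed_perm_unit up) urise pL.
exists a; split=> //; first exact: opposite_rise_rational surise.
exact: coxeter_length_simple_refl up par apos.
Qed.
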